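(* Let $k\ge1$ and $n\ge1$, and let $P$ be a $k$-Dyck path of length $n$ with associated ascending parking preference $\alpha=(a_1,\dots,a_n)$. Then $\alpha$ is a $k$-Naples parking function if and only if, for every Down step of $P$ that takes the path below the line $y=0$ (i.e. from height $0$ to height $-1$), the path crosses back above the line $y=0$ (reaches height $1$) at some point within the $2k$ steps immediately following that Down step.
   Context: A lattice path consists of Up steps $(1,1)$ and Down steps $(1,-1)$ starting at $(0,0)$. A $k$-Dyck path of length $n$ is such a path with $n$ Up steps and $n$ Down steps (so it ends at $(2n,0)$) that never goes below the line $y=-k$ and whose last step is a Down step. The associated parking preference of $P$ is $\alpha=(a_1,\dots,a_n)$ where $a_i$ is $1$ plus the number of Down steps preceding the $i$-th Up step; it is weakly increasing. Parking rules: $n$ spots $1,\dots,n$, cars $c_1,\dots,c_n$ arrive in order, $a_j$ is the preferred spot of $c_j$; $k$-Naples rule: $c_j$ parks at $a_j$ if empty, otherwise checks $a_j-1,\dots,a_j-k$ (those $\ge1$) in order and parks at the first empty one, otherwise drives forward from $a_j$ and parks at the first empty spot after $a_j$ (failing if none). The preference is a $k$-Naples parking function if all cars park. *)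

(* Defs.v *)
From mathcomp Require Import all_boot all_order all_algebra.
Set Implicit Arguments.
Unset Strict Implicit.
Unset Printing Implicit Defensive.

Definition step := bool.
Definition Up : step := true.
Definition Down : step := false.

Definition height (P : seq step) (i : nat) : int :=
  ((count_mem Up (take i P))%:Z - (count_mem Down (take i P))%:Z)%R.

(* The default [Up] in [last] makes the empty path fail the last condition. *)
Definition kDyck (k n : nat) (P : seq step) : Prop :=
  [/\ count_mem Up P = n,
      count_mem Down P = n,
      forall i, i <= size P -> (- k%:Z <= height P i)%R &
      last Up P = Down].

(* The positions [j] of the Up steps are enumerated from left to right. *)
Definition preference (P : seq step) : seq nat :=
  [seq (count_mem Down (take j P)).+1
     | j <- iota 0 (size P) & nth Down P j == Up].

(* Spots examined, in order, by a car preferring [a]. When [i >= a] the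
   truncated difference [a - i] is 0, which the filter discards. *)
Definition naples_spots (k n a : nat) : seq nat :=
  [seq s <- a :: [seq a - i | i <- iota 1 k] ++ iota a.+1 (n - a)
     | 1 <= s <= n].

Definition naples_spot (k n : nat) (occ : seq nat) (a : nat) : option nat :=
  ohead [seq s <- naples_spots k n a | s \notin occ].

(* [occ] lists the occupied spots; [None] means that some car fails to park. *)
Fixpoint naples_park (k n : nat) (occ alpha : seq nat) : option (seq nat) :=
  if alpha is a :: alpha' then
    if naples_spot k n occ a is Some s
    then naples_park k n (s :: occ) alpha' else None
  else Some occ.

Definition kNaples (k : nat) (alpha : seq nat) : Prop :=
  naples_park k (size alpha) [::] alpha <> None.

(* Step number [i] (from 0) goes from height [height P i] to
   [height P i.+1]; the [m] steps following it end at the abscissas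
   [i.+2, ..., i.+1 + m]. *)
Definition reaches_one_within (m : nat) (P : seq step) (i : nat) : Prop :=
  exists j, [/\ i.+1 < j <= i.+1 + m, j <= size P & height P j = 1%R].

(* Main.v *)
(** Write [u] and [d] for the numbers of Up and Down steps read so far; the
    next car prefers [d + 1].  As long as the path is not below [y = 0], the
    occupied spots are exactly [1, ..., u].  When the path drops below [y = 0]
    with [u = d = m], spot [m + 1] is skipped.  From then on every car takes
    the nearest hole at or behind its preference, so spot [m + 1] is the last
    hole to be filled, and this must happen at the step that brings the path
    to height [1].  That car prefers [d + 1], hence it reaches [m + 1] iff
    [d - m <= k]; exactly [2 * (d - m)] steps have followed the drop by then.
    If it does not, the hole stays out of reach forever and [n] cars cannot
    all park. *)
Require Import Defs.
From mathcomp Require Import all_boot all_order all_algebra.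
From mathcomp Require Import zify.

(** * Step counts and heights *)

Definition ups (P : seq step) : nat := count_mem Up P.
Definition downs (P : seq step) : nat := count_mem Down P.

Lemma ups_cat (P Q : seq step) : ups (P ++ Q) = ups P + ups Q.
Proof. exact: count_cat. Qed.

Lemma downs_cat (P Q : seq step) : downs (P ++ Q) = downs P + downs Q.
Proof. exact: count_cat. Qed.

Lemma ups_cons (x : step) (P : seq step) : ups (x :: P) = (x == Up) + ups P.
Proof. by []. Qed.

Lemma downs_cons (x : step) (P : seq step) :
  downs (x :: P) = (x == Down) + downs P.
Proof. by []. Qed.

Lemma ups_rcons (P : seq step) (x : step) : ups (rcons P x) = ups P + (x == Up).
Proof. by rewrite -cats1 ups_cat /ups /= addn0. Qed.

Lemma downs_rcons (P : seq step) (x : step) :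
  downs (rcons P x) = downs P + (x == Down).
Proof. by rewrite -cats1 downs_cat /downs /= addn0. Qed.

Arguments ups : simpl never.
Arguments downs : simpl never.

Definition counts_cat := (ups_cat, downs_cat).
Definition counts_cons := (ups_cons, downs_cons).
Definition counts_rcons := (ups_rcons, downs_rcons).

Lemma heightE (P : seq step) (i : nat) :
  height P i = ((ups (take i P))%:Z - (downs (take i P))%:Z)%R.
Proof. by []. Qed.

Lemma height_le (P : seq step) (l j : nat) :
  l <= j -> (height P j <= height P l + (j - l)%:Z)%R.
Proof.
move=> le_lj; rewrite !heightE.
have -> : take j P = take l P ++ take (j - l) (drop l P).
  by rewrite -takeD subnKC.
rewrite !counts_cat.
have : ups (take (j - l) (drop l P)) <= j - l.
  by apply: leq_trans (count_size _ _) _; rewrite size_take_min geq_minl.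
lia.
Qed.

Lemma height_cat (pre Q : seq step) :
  height (pre ++ Q) (size pre) = ((ups pre)%:Z - (downs pre)%:Z)%R.
Proof. by rewrite heightE take_size_cat. Qed.

Lemma ups_downs (P : seq step) : ups P + downs P = size P.
Proof.
rewrite -(count_predC (pred1 Up) P); congr (_ + _).
by apply: eq_count; case.
Qed.

(** * Preferences read off recursively, [d] being the Down steps already read *)

Fixpoint preference_from (d : nat) (Q : seq step) : seq nat :=
  if Q is x :: Q' then
    if x then d.+1 :: preference_from d Q' else preference_from d.+1 Q'
  else [::].

(** [preference] uses absolute positions, so the induction on the unread part [Q] has to carry the
    prefix [pre]. *)
Lemma preference_from_cat (Q pre : seq step) :
  [seq (downs (take j (pre ++ Q))).+1
     | j <- iota (size pre) (size Q) & nth Down (pre ++ Q) j == Up]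
  = preference_from (downs pre) Q.
Proof.
elim: Q pre => [//|x Q IH] pre; rewrite [iota _ _]/= [filter _ _]/=.
rewrite nth_cat ltnn subnn /=; have := IH (rcons pre x).
rewrite size_rcons cat_rcons downs_rcons.
case: x => /=; last by rewrite addn1.
by rewrite !addn0 take_size_cat // => <-.
Qed.

Lemma preferenceE (P : seq step) : preference P = preference_from 0 P.
Proof. exact: (preference_from_cat P [::]). Qed.

Lemma size_preference_from (d : nat) (Q : seq step) :
  size (preference_from d Q) = ups Q.
Proof. by elim: Q d => [|[] Q IH] d //=; rewrite IH ups_cons. Qed.

Lemma preference_from_gt (d : nat) (Q : seq step) (a : nat) :
  a \in preference_from d Q -> d < a.
Proof.
elim: Q d => [|[] Q IH] d //=; last by move/IH/ltnW.
by rewrite inE => /predU1P[->|/IH].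
Qed.

(** * The spot taken by a single car *)

Lemma ohead_mem (T : eqType) (s : seq T) (x : T) : ohead s = Some x -> x \in s.
Proof. by case: s => //= y s [->]; rewrite mem_head. Qed.

Lemma ohead_filter_sorted (p : pred nat) (s t : seq nat) (x : nat) :
  sorted geq s -> x \in s -> p x ->
  exists y, [/\ ohead (filter p (s ++ t)) = Some y, y \in s, p y & x <= y].
Proof.
elim: s => [//|z s IH] /= sorted_s; rewrite inE.
case: ifPn => [pz|npz] x_in px.
  exists z; split; rewrite ?mem_head //.
  case/predU1P: x_in => [->//|x_s].
  by move/(order_path_min (rev_trans leq_trans))/allP/(_ _ x_s): sorted_s.
case/predU1P: x_in => [exz|x_s]; first by rewrite -exz px in npz.
have [y [hy y_s py le_xy]] := IH (path_sorted sorted_s) x_s px.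
by exists y; split; rewrite // inE y_s orbT.
Qed.

(** The preferred spot is the backward move of length 0, so it joins the backward spots in one
    descending list. *)
Lemma naples_spotE (k n : nat) (occ : seq nat) (a : nat) :
  naples_spot k n occ a =
  ohead [seq s <- [seq a - i | i <- iota 0 k.+1] ++ iota a.+1 (n - a)
           | (s \notin occ) && (1 <= s <= n)].
Proof. by rewrite /naples_spot /naples_spots -filter_predI /= subn0. Qed.

Lemma naples_spotP (k n : nat) (occ : seq nat) (a s : nat) :
  naples_spot k n occ a = Some s ->
  [/\ s \notin occ, s \in iota 1 n & a <= s + k].
Proof.
rewrite naples_spotE => /ohead_mem.
rewrite mem_filter mem_cat mem_iota => /andP[/andP[-> s_bd] s_in]; split=> //.
  by rewrite mem_iota add1n ltnS.
case/orP: s_in => [/mapP[i]|]; rewrite ?mem_iota; lia.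
Qed.

(** Spots behind are tried nearest first, so an empty [s0] within reach stops the car there or
    earlier, before it would drive forward. *)
Lemma naples_spot_back (k n : nat) (occ : seq nat) (a s0 : nat) :
  a <= n -> 0 < s0 <= a -> a <= s0 + k -> s0 \notin occ ->
  exists s, [/\ naples_spot k n occ a = Some s, s \notin occ & s0 <= s <= a].
Proof.
move=> le_an s0_bd le_as s0_occ; rewrite naples_spotE.
have [|||s [-> s_in /andP[s_occ _] le_s]] :=
  @ohead_filter_sorted (fun s => (s \notin occ) && (1 <= s <= n))
    [seq a - i | i <- iota 0 k.+1] (iota a.+1 (n - a)) s0.
- apply: (homo_sorted (e := leq)) (iota_sorted 0 k.+1) => i j le_ij /=.
  exact: leq_sub2l.
- by apply/mapP; exists (a - s0); rewrite ?mem_iota; lia.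
- by rewrite s0_occ /=; lia.
exists s; split=> //; rewrite le_s /=.
by case/mapP: s_in => i _ ->; rewrite leq_subr.
Qed.

Lemma naples_spot_prefix (k n : nat) (occ : seq nat) (u a : nat) :
  occ =i iota 1 u -> 0 < a <= u.+1 -> u < n ->
  naples_spot k n occ a = Some u.+1.
Proof.
move=> occE a_bd lt_un; case: (eqVneq a u.+1) => [->|ne_au].
  have [||||s [-> _ s_bd]] := @naples_spot_back k n occ u.+1 u.+1 => //.
  - by rewrite leqnn.
  - exact: leq_addr.
  - by rewrite occE mem_iota add1n ltnn andbF.
  by congr Some; lia.
rewrite naples_spotE.
(* Cut the forward spots just before [u.+1]: all candidates before the cut are occupied or out of
   range. *)
have -> : n - a = (u - a) + (n - u.+1).+1 by lia.
rewrite iotaD catA filter_cat; have -> : a.+1 + (u - a) = u.+1 by lia.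
set s := filter _ _; have -> : s = [::].
  apply/eqP; rewrite -[_ == _]negbK -has_filter; apply/hasPn=> x.
  rewrite mem_cat occE !mem_iota => /orP[/mapP[i _ ->]|x_in]; lia.
by rewrite /= occE mem_iota /= add1n ltnn lt_un.
Qed.

(** * Complete runs of the parking process *)

Lemma naples_park_inv (k n : nat) (alpha occ occ' : seq nat) :
  naples_park k n occ alpha = Some occ' ->
  uniq occ -> {subset occ <= iota 1 n} ->
  [/\ uniq occ', {subset occ' <= iota 1 n}, size occ' = size occ + size alpha &
      forall s, s \notin occ -> (forall a, a \in alpha -> s + k < a) ->
        s \notin occ'].
Proof.
elim: alpha occ => [|a alpha IH] occ /=.
  by case=> <-; rewrite addn0; split.
case Es: naples_spot => [s|//] /IH{}IH uniq_occ sub_occ.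
have [s_occ s_n le_as] := naples_spotP _ _ _ _ _ Es.
have [||? ? sz_occ' hole] := IH; first by rewrite /= s_occ.
  by move=> x; rewrite inE => /predU1P[->//|/sub_occ].
split=> //; first by rewrite sz_occ' addnS.
move=> x x_occ far; apply: hole => [|b b_in].
  rewrite inE negb_or x_occ andbT; apply/eqP=> exs.
  have := far a (mem_head _ _); lia.
by apply: far; rewrite inE b_in orbT.
Qed.

(** Success would put [n] cars on [n] spots and so fill [s], yet no remaining car can back up as far
    as [s]. *)
Lemma naples_park_unreachable (k n : nat) (alpha occ : seq nat) (s : nat) :
  uniq occ -> {subset occ <= iota 1 n} -> size occ + size alpha = n ->
  s \in iota 1 n -> s \notin occ -> (forall a, a \in alpha -> s + k < a) ->
  naples_park k n occ alpha = None.
Proof.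
move=> uniq_occ sub_occ sz s_n s_occ far.
case Ep: naples_park => [occ'|//].
have [uniq_occ' sub_occ' sz' hole] :=
  naples_park_inv _ _ _ _ _ Ep uniq_occ sub_occ.
have [_ eq_occ'] : (size occ' = size (iota 1 n)) * (occ' =i iota 1 n).
  by apply: uniq_min_size => //; rewrite sz' sz size_iota.
by have := hole s s_occ far; rewrite eq_occ' s_n.
Qed.

(** * Drops below the axis and the skipped spot *)

Definition returns_from (k : nat) (P : seq step) (l : nat) : Prop :=
  forall i, l <= i -> i < size P -> nth Up P i = Down -> height P i = 0%R ->
    reaches_one_within (2 * k) P i.

Lemma returns_from_cons (k : nat) (pre Q : seq step) (x : step) :
  returns_from k (pre ++ x :: Q) (size pre) <->
  (x = Down -> ups pre = downs pre ->
     reaches_one_within (2 * k) (pre ++ x :: Q) (size pre)) /\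
  returns_from k (pre ++ x :: Q) (size pre).+1.
Proof.
split=> [ret|[here ret] i].
  split=> [xD eq_ud|i /ltnW]; last exact: ret.
  apply: ret => //; first by rewrite size_cat /= addnS ltnS leq_addr.
    by rewrite nth_cat ltnn subnn.
  by rewrite height_cat eq_ud GRing.subrr.
rewrite leq_eqVlt => /predU1P[<- _|lt_i]; last exact: ret.
rewrite nth_cat ltnn subnn height_cat /= => xD ht0; apply: here => //; lia.
Qed.

(* [m] is the common number of Up and Down steps before the drop, so the drop
   is step number [m.*2] and the skipped spot is [m.+1]. *)
Definition skipping (m : nat) (pre Q : seq step) (occ : seq nat) : Prop :=
  [/\ ups pre <= downs pre, m < downs pre,
      forall j, m.*2 < j <= size pre -> height (pre ++ Q) j <> 1%R &
      [/\ uniq occ, size occ = ups pre,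
      {subset occ <= iota 1 (downs pre).+1},
      {subset iota 1 m <= occ} & m.+1 \notin occ]].

(** Ensures that the spot [(downs pre).+1] preferred at this Up step is at most [n]. *)
Lemma Down_ahead (pre Q : seq step) :
  last Up (pre ++ Up :: Q) = Down -> 0 < downs Q.
Proof.
rewrite last_cat /= => lastD; rewrite -has_count has_pred1.
by have := mem_last Up Q; rewrite lastD inE.
Qed.

Lemma skipping_start (pre Q : seq step) (occ : seq nat) :
  ups pre = downs pre -> uniq occ ->
  occ =i iota 1 (ups pre) ->
  skipping (ups pre) (rcons pre Down) Q occ.
Proof.
move=> eq_ud uniq_occ occE.
rewrite /skipping size_rcons cat_rcons !counts_rcons addn0 addn1 -eq_ud.
split=> // [j j_bd|].
  (* The end of the drop is the only abscissa in the range. *)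
  have -> : j = size (rcons pre Down).
    by rewrite size_rcons; have := ups_downs pre; lia.
  rewrite -cat_rcons height_cat !counts_rcons /=; lia.
split=> //.
- by rewrite (perm_size (uniq_perm uniq_occ (iota_uniq 1 _) occE)) size_iota.
- by move=> s; rewrite occE !mem_iota; lia.
- by move=> s; rewrite occE.
- by rewrite occE mem_iota; lia.
Qed.

Lemma skipping_step (m : nat) (pre Q : seq step) (x : step)
    (occ occ' : seq nat) :
  skipping m pre (x :: Q) occ ->
  ups (rcons pre x) <= downs (rcons pre x) ->
  uniq occ' -> size occ' = ups (rcons pre x) ->
  {subset occ' <= iota 1 (downs pre).+1} ->
  {subset occ <= occ'} -> m.+1 \notin occ' ->
  skipping m (rcons pre x) Q occ'.
Proof.
case=> [le_ud lt_md low [_ _ _ sub_m _]] le_ud' uniq' sz' sub' sub hole.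
have le_d : downs pre <= downs (rcons pre x).
  by rewrite downs_rcons leq_addr.
split=> //; first exact: leq_trans lt_md le_d.
  move=> j; rewrite size_rcons => /andP[lt_mj]; rewrite leq_eqVlt ltnS.
  case/predU1P=> [->|le_j]; last first.
    by rewrite cat_rcons; apply: low; rewrite lt_mj.
  by rewrite -(size_rcons pre x) height_cat; lia.
split=> // s; last by move/sub_m/sub.
by move/sub'; rewrite !mem_iota; lia.
Qed.

(** Later cars prefer spots beyond [m.+1 + k]. Reaching height 1 takes at least as many Up steps as
    Down steps so far, plus one, hence more than the [2 * k] steps allowed. *)
Lemma skipping_late (k n m : nat) (pre Q : seq step) (occ : seq nat) :
  ups (pre ++ Q) = n -> downs (pre ++ Q) = n ->
  skipping m pre Q occ -> {subset occ <= iota 1 n} ->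
  k < downs pre - m ->
  naples_park k n occ (preference_from (downs pre) Q) = None /\
  ~ reaches_one_within (2 * k) (pre ++ Q) m.*2.
Proof.
move=> cntU cntD [le_ud lt_md low [uniq_occ sz_occ _ _ hole]] sub_occ lt_k.
rewrite !counts_cat in cntU cntD; have sz := ups_downs pre; split.
  apply: (naples_park_unreachable _ _ _ _ m.+1) => //.
  - by rewrite sz_occ size_preference_from.
  - by rewrite mem_iota; lia.
  - by move=> a /preference_from_gt; lia.
case=> j [j_bd _ htj].
case: (leqP j (size pre)) => [le_j|lt_j]; first by apply: (low j) => //; lia.
by have := height_le (pre ++ Q) _ _ (ltnW lt_j); rewrite htj height_cat; lia.
Qed.

(** Pigeonhole: without [m.+1], the first [(downs pre).+1] spots still number [downs pre], more than
    the parked cars; the empty one lies past the full block [1, ..., m]. *)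
Lemma skipping_hole (m : nat) (pre Q : seq step) (occ : seq nat) :
  skipping m pre Q occ -> ups pre < downs pre ->
  exists s, [/\ m.+1 < s, s <= (downs pre).+1 & s \notin occ].
Proof.
case=> [_ lt_md _ [_ sz_occ _ sub_m hole]] lt_ud.
pose r := rem m.+1 (iota 1 (downs pre).+1).
have uniq_r : uniq r by rewrite rem_uniq ?iota_uniq.
have sz_r : size r = downs pre.
  by rewrite size_rem ?size_iota // mem_iota; lia.
have /allPn[s] : ~~ all (mem occ) r.
  apply/negP=> /allP sub_r; have := uniq_leq_size uniq_r sub_r.
  by rewrite sz_r sz_occ leqNgt lt_ud.
rewrite mem_rem_uniq ?iota_uniq // inE mem_iota => /andP[ne_s s_bd] s_occ.
exists s; split=> //; last lia.
have : s \notin iota 1 m by apply: contra s_occ => /sub_m.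
by rewrite mem_iota; move: ne_s => /= ; lia.
Qed.

(** * Induction along the path *)

(** The two claims are proved together because the path alternates between their situations. In the
    second, the pending drop lies in the prefix, so its return is a separate conjunct. *)
Lemma park_iff_returns (k n : nat) (Q pre : seq step) (occ : seq nat) :
  ups (pre ++ Q) = n -> downs (pre ++ Q) = n ->
  last Up (pre ++ Q) = Down ->
  let parks :=
    naples_park k n occ (preference_from (downs pre) Q) <> None in
  (downs pre <= ups pre -> uniq occ ->
   occ =i iota 1 (ups pre) ->
     parks <-> returns_from k (pre ++ Q) (size pre)) /\
  (forall m, skipping m pre Q occ -> {subset occ <= iota 1 n} ->
     parks <-> reaches_one_within (2 * k) (pre ++ Q) m.*2 /\
               returns_from k (pre ++ Q) (size pre)).
Proof.
elim: Q pre occ => [|x Q IH] pre occ cntU cntD lastD parks.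
  move: cntU cntD; rewrite cats0 => cntU cntD; split=> [_ _ _|m].
    by split=> // _ i le_i lt_i; lia.
  case=> [le_ud lt_md _ [uniq_occ sz_occ _ _ hole]] sub_occ.
  (* At the end of the path all [n] spots would be occupied, including the skipped one. *)
  exfalso; move/negP: hole; apply.
  have [_ ->] : (size occ = size (iota 1 n)) * (occ =i iota 1 n).
    by apply: uniq_min_size => //; rewrite size_iota sz_occ cntU.
  by rewrite mem_iota; lia.
have [cntU' cntD'] := (cntU, cntD).
rewrite !counts_cat !counts_cons in cntU' cntD'.
have sz_pre := ups_downs pre.
have {}IH occ' := IH (rcons pre x) occ'.
rewrite cat_rcons !counts_rcons size_rcons in IH.
have {}IH occ' := IH occ' cntU cntD lastD.
split=> [le_du uniq_occ occE|m skip sub_occ].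
  rewrite returns_from_cons.
  case: x => [|] in cntU cntD lastD parks cntU' cntD' IH *.
    have lt_un : ups pre < n by move: cntU' => /=; lia.
    rewrite /parks /= (naples_spot_prefix _ _ _ _ _ occE) //.
    have [IHA _] := IH ((ups pre).+1 :: occ).
    rewrite /= addn0 addn1 in IHA; rewrite IHA; first by split=> [|[]].
    - exact: leqW.
    - by rewrite /= uniq_occ occE mem_iota add1n ltnn andbF.
    - by move=> s; rewrite inE occE !mem_iota; lia.
  rewrite /parks /=; have [IHA IHB] := IH occ.
  rewrite /= addn0 addn1 in IHA IHB.
  case: (eqVneq (ups pre) (downs pre)) => [eq_ud|ne_ud].
    (* A drop from height 0: pass to the second claim with [m] equal to [ups pre]. *)
    rewrite (IHB (ups pre)).
    - rewrite -sz_pre -eq_ud addnn.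
      split=> [[reach ret]|[/(_ erefl erefl) reach ret]]; last by split.
      by split=> // _ _.
    - exact: skipping_start.
    - by move=> s; rewrite occE !mem_iota; lia.
  rewrite IHA //; last by lia.
  split=> [ret|[_ ret]] //; split=> // _ eq_ud.
  by rewrite eq_ud eqxx in ne_ud.
(* If the hole is already out of reach, both sides are false. *)
have [lt_k|le_k] := ltnP k (downs pre - m).
  have [noP noR] := skipping_late _ _ _ _ _ _ cntU cntD skip sub_occ lt_k.
  by split=> [|[]].
have [le_ud lt_md low [uniq_occ sz_occ sub_occ' sub_m hole]] := skip.
rewrite returns_from_cons.
case: x => [|] in cntU cntD lastD parks cntU' cntD' IH skip low *; last first.
  rewrite /parks /=; have [_ IHB] := IH occ; rewrite /= ?addn0 ?addn1 in IHB.
  rewrite (IHB m) //; last first.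
    apply: (skipping_step _ _ _ _ occ) => //;
      rewrite !counts_rcons /= ?addn0 //.
    exact: leq_trans le_ud (leq_addr _ _).
  split=> [[reach ?]|[? []]] //; split=> //; split=> // _ eq_ud.
  (* A further drop before height [1] is reached: the same return serves it. *)
  case: reach => j [j_bd le_j htj]; exists j; split=> //.
  case: (leqP j (size pre).+1) => [le_jl|]; last by lia.
  exfalso; move: le_jl; rewrite leq_eqVlt ltnS => /predU1P[jE|le_jl].
    move: htj; rewrite jE -cat_rcons -(size_rcons pre false) height_cat.
    by rewrite !counts_rcons /=; lia.
  by apply: (low j) => //; lia.
have D_Q := Down_ahead _ _ lastD.
have lt_dn : downs pre < n by move: cntD' => /=; lia.
rewrite /parks /=; case: (ltnP (ups pre) (downs pre)) => [lt_ud|ge_ud].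
  (* Still below the axis: a hole nearer than [m.+1] absorbs this car, so [m.+1] stays empty. *)
  have [s0 [gt_s0 le_s0 s0_occ]] := skipping_hole _ _ _ _ skip lt_ud.
  have [||||s [-> s_occ s_bd]] :=
    @naples_spot_back k n occ (downs pre).+1 s0 => //; [lia|lia|].
  have [_ IHB] := IH (s :: occ); rewrite /= ?addn0 ?addn1 in IHB.
  rewrite (IHB m); first by split=> [[]|[? []]].
    apply: (skipping_step _ _ _ _ occ) => //;
      rewrite ?counts_rcons ?addn0 ?addn1 //.
    - by rewrite /= s_occ.
    - by rewrite /= sz_occ.
    - move=> r; rewrite inE => /predU1P[->|/sub_occ'//].
      by rewrite mem_iota; lia.
    - by move=> r r_occ; rewrite inE r_occ orbT.
    - by rewrite inE negb_or hole andbT; lia.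
  by move=> r; rewrite inE => /predU1P[->|/sub_occ//]; rewrite mem_iota; lia.
have eq_ud : ups pre = downs pre by lia.
(* From height 0, [m.+1] is within reach. The car's spot completes [1, ..., (ups pre).+1] by
   counting, which restores the first situation. *)
have [||||s [-> s_occ s_bd]] :=
  @naples_spot_back k n occ (downs pre).+1 m.+1 => //; [lia|lia|].
have [IHA _] := IH (s :: occ); rewrite /= addn0 addn1 in IHA.
have uniq_s : uniq (s :: occ) by rewrite /= s_occ.
rewrite IHA //; [|exact: leqW|]; last first.
  have sub_s : {subset s :: occ <= iota 1 (ups pre).+1}.
    move=> r; rewrite inE eq_ud => /predU1P[->|/sub_occ'//].
    by rewrite mem_iota; lia.
  have [|_ eq_s] := uniq_min_size uniq_s sub_s; last exact: eq_s.
  by rewrite size_iota /= sz_occ.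
split=> [ret|[_ []]] //; split; last by split.
(* The end of this Up step is the return; [downs pre - m <= k] is exactly the bound needed. *)
exists (size pre).+1; split; first by lia.
  by rewrite size_cat /= addnS ltnS leq_addr.
rewrite -cat_rcons -(size_rcons pre true) height_cat !counts_rcons /=; lia.
Qed.

Theorem theorem3p5 (k n : nat) (k_ge1 : 1 <= k) (n_ge1 : 1 <= n)
    (P : seq step) (P_kDyck : kDyck k n P) :
  kNaples k (preference P) <->
  (forall i : nat, i < size P -> nth Up P i = Down -> height P i = 0%R ->
     reaches_one_within (2 * k) P i).
Proof.
case: P_kDyck => cntU cntD _ lastD.
rewrite /kNaples preferenceE size_preference_from [ups P]cntU.
have [iff_ret _] := park_iff_returns k n P [::] [::] cntU cntD lastD.
rewrite iff_ret //.
by split=> ret i; [apply: ret | move=> _; apply: ret].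
Qed.
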